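(* For every integer $t\ge 2$, the number of faultfree tromino tilings of the rectangle $R(6,6t)$ is at least $$128\,(t+1)\,144^{\,t-2}.$$
   Context: $R(m,n)$ denotes the rectangle with $m$ rows and $n$ columns of unit squares. A tromino is an L-shaped tromino, i.e. a $2\times 2$ block of unit squares with one unit square removed, in any of its four orientations. A tromino tiling of $R(m,n)$ is a partition of its unit squares into trominoes. A fault line of a tiling is a horizontal or vertical line that cuts the rectangle into two (nonempty) pieces and does not pass through any of the tiles. A tiling is faultfree if it has no fault line. Tilings are counted as distinct whenever they differ as partitions (no identification under symmetries). *)

(* Defs.v *)
From mathcomp Require Import all_boot.

Set Implicit Arguments.
Unset Strict Implicit.
Unset Printing Implicit Defensive.

(* A unit square of R(m, n) is a pair (row, column). *)
Definition square (m n : nat) : finType := ('I_m * 'I_n)%type.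

(* The parameters i, j are the row and column of the corner with the smallest
   indices; this is a full 2 x 2 block only when i.+1 < m and j.+1 < n. *)
Definition block2 (m n i j : nat) : {set square m n} :=
  [set c : square m n | (i <= c.1 <= i.+1) && (j <= c.2 <= j.+1)].

Definition is_tromino (m n : nat) (T : {set square m n}) : bool :=
  [exists i : 'I_m, exists j : 'I_n,
    [&& i.+1 < m, j.+1 < n &
        [exists c in block2 m n i j, T == block2 m n i j :\ c]]].

Definition tromino_tiling (m n : nat) (P : {set {set square m n}}) : bool :=
  partition P [set: square m n] && [forall T in P, is_tromino T].

(* Only grid lines are considered, since any other horizontal or vertical line
   meeting the interior of the rectangle cuts unit squares.  The horizontal line
   number h separates the rows < h from the rows >= h, and it cuts the rectangle
   into two nonempty pieces exactly when 0 < h < m.  Similarly for columns. *)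
Definition horizontal_fault (m n : nat) (P : {set {set square m n}})
    (h : nat) : bool :=
  (0 < h < m) &&
  [forall T in P, [forall c in T, c.1 < h] || [forall c in T, h <= c.1]].

Definition vertical_fault (m n : nat) (P : {set {set square m n}})
    (v : nat) : bool :=
  (0 < v < n) &&
  [forall T in P, [forall c in T, c.2 < v] || [forall c in T, v <= c.2]].

Definition faultfree (m n : nat) (P : {set {set square m n}}) : bool :=
  [forall h : 'I_m, ~~ horizontal_fault P h] &&
  [forall v : 'I_n, ~~ vertical_fault P v].

Definition faultfree_tilings (m n : nat) : {set {set {set square m n}}} :=
  [set P : {set {set square m n}} | tromino_tiling P && faultfree P].

(* Main.v *)
Require Import Defs.
From mathcomp Require Import all_boot zify.

Set Implicit Arguments.
Unset Strict Implicit.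
Unset Printing Implicit Defensive.

(** The tilings are counted from below by the transfer matrix method, scanning
the columns of R(6, n) from left to right.

Attach each tromino to the left one of the two columns that it meets.  A
tiling is then a word with one letter per column, the letter listing the
trominoes attached to that column ([move]).  Whether a letter may follow
another depends only on the set of rows that the earlier trominoes already
occupy in the current column ([profile]): the letter must fill the rest of the
column without overlaps ([fits]).  A column boundary is a fault line exactly
when the profile there is empty, so words that meet the empty profile only at
their two ends ([fault_avoiding]) have no vertical fault.  Conversely the tiling
determines the word ([tiling_of_word_inj]), hence counting tilings amounts to
counting words.

Horizontal faults are excluded once and for all by starting every word with the
two columns [lock], whose five trominoes have their 2 x 2 blocks at five
different heights and so cross all five horizontal lines.  After them the
occupied rows are [lock_profile], and each [completions] of this profile
to n columns gives a different faultfree tiling of R(6, n + 2)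
([faultfree_ge_completions]).

Let f n s be the number of completions of the profile s in n columns.  It
satisfies the linear recurrence with nonnegative coefficients
f (n + 1) s = sum of f n (after m) over the letters m that fit s, for s nonempty.
Therefore an inequality 192 f n <= f (n + 6), once it holds for all profiles at
n = 4, propagates to every larger n ([completions_grow]).  A finite computation
gives this inequality and f 10 [lock_profile] >= 384, so that
f (6 t - 2) [lock_profile] >= 384 * 192 ^ (t - 2).  Finally 192 = 144 * (4 / 3) and
Bernoulli's inequality (4 / 3) ^ k >= 1 + k / 3 gives
384 * 192 ^ (t - 2) >= 128 (t + 1) 144 ^ (t - 2). *)

(** * Columns, profiles and words *)

(** [(i, a, b)] is the tromino in the 2 x 2 block with top row [i] that lacks the
square in row [i + a] of its left ([b = false]) or right ([b = true]) column. *)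
Definition placement : Type := (nat * bool * bool)%type.

Definition row (p : placement) : nat := p.1.1.

(** The column offset [d] is counted from the left column of the block. *)
Definition covers (p : placement) (r d : nat) : bool :=
  [&& row p <= r <= (row p).+1, d <= 1 & ~~ ((r == row p + p.1.2) && (d == p.2))].

Definition profile := bitseq.

Definition move := seq placement.

Definition load (s : profile) (m : move) (r d : nat) : nat :=
  (d == 0) && nth false s r + count (fun p => covers p r d) m.

(** Overlaps in the next column are limited to those within one move; that it
does not collide with the following move is the first condition on the latter. *)
Definition no_overlap (s : profile) (m : move) : bool :=
  all (fun r => (load s m r 0 <= 1) && (load s m r 1 <= 1)) (iota 0 6).

(** Sortedness by row makes a move determined by its set of trominoes. *)
Definition fits (s : profile) (m : move) : bool :=
  [&& all (fun p => row p < 5) m, sorted (relpre row ltn) m, no_overlap s m &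
      all (fun r => load s m r 0 == 1) (iota 0 6)].

Definition after (m : move) : profile :=
  mkseq (fun r => has (fun p => covers p r 1) m) 6.

Definition flat : profile := nseq 6 false.

Fixpoint fault_avoiding (s : profile) (w : seq move) : bool :=
  if w is m :: w' then
    [&& fits s m, (after m != flat) || nilp w' & fault_avoiding (after m) w']
  else s == flat.

(** Only the preceding letter matters, since a tromino spans two columns. *)
Definition incoming (s : profile) (w : seq move) (x : nat) : profile :=
  if x is y.+1 then after (nth [::] w y) else s.

Lemma fault_avoidingP s w : fault_avoiding s w ->
  [/\ forall x, x < size w -> fits (incoming s w x) (nth [::] w x),
      forall x, 0 < x < size w -> incoming s w x != flat
    & incoming s w (size w) = flat].
Proof.
elim: w s => [|m w IHw] s; first by move=> /eqP ->; split=> // -[|x].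
rewrite /=; case/and3P=> fit_m flat_m /IHw [fit_w flat_w end_w]; split.
- by case=> [|[|x]] //= ltxw; [apply: (fit_w 0) | apply: (fit_w x.+1)].
- case=> [|[|x]] //= ltxw; last exact: (flat_w x.+1).
  by move: flat_m; case: (w) ltxw => //= ? ? _; rewrite orbF.
- by case: w end_w {IHw fit_w flat_w flat_m}.
Qed.

(** * From words to tilings *)

Definition footprint (n j : nat) (p : placement) : {set square 6 n} :=
  [set c : square 6 n | (j <= c.2) && covers p c.1 (c.2 - j)].

Definition tiling_of_word (n : nat) (w : seq move) : {set {set square 6 n}} :=
  [set T | [exists j : 'I_n,
     has (fun p => T == footprint n j p) (nth [::] w j)]].

Lemma tiling_of_wordP n w T :
  reflect (exists (j : 'I_n) p, p \in nth [::] w j /\ T = footprint n j p)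
          (T \in tiling_of_word n w).
Proof.
rewrite inE; apply: (iffP existsP) => [[j /hasP[p pw /eqP->]]|[j [p [pw ->]]]].
  by exists j, p.
by exists j; apply/hasP; exists p.
Qed.

Lemma mem_footprint n j p (r : 'I_6) (x : 'I_n) :
  ((r, x) \in footprint n j p) = (j <= x) && covers p r (x - j).
Proof. by rewrite inE. Qed.

(** Every tromino has a square in each row and each column of its block, so an
equality of footprints forces the blocks to start at the same place. *)
Lemma footprint_sub n j p j' p' : row p < 5 -> j.+1 < n ->
  footprint n j p = footprint n j' p' -> j' <= j /\ row p' <= row p.
Proof.
case: p => [[i a] b]; case: p' => [[i' a'] b']; rewrite /row /= => lti ltj E.
have {}E r x : r < 6 -> x < n -> (j <= x) && covers (i, a, b) r (x - j) ->
    (j' <= x) && covers (i', a', b') r (x - j').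
  move=> ltr ltx; move/setP/(_ (Ordinal ltr, Ordinal ltx)): E.
  by rewrite !mem_footprint /= => ->.
(* Squares of the left column and of the top row, away from the corner. *)
have E1 := E (i + ~~ a) j; have E2 := E i (j + ~~ b).
rewrite /covers /row /= in E1 E2.
by split; [case: a E1 {E E2}|case: b E2 {E E1}]; lia.
Qed.

Lemma footprint_inj n j p j' p' :
  row p < 5 -> j.+1 < n -> row p' < 5 -> j'.+1 < n ->
  footprint n j p = footprint n j' p' -> j = j' /\ p = p'.
Proof.
move=> ltp ltj ltp' ltj' E.
have [lj lr] := footprint_sub ltp ltj E.
have [gj gr] := footprint_sub ltp' ltj' (esym E).
have ej : j = j' by lia.
split=> //; subst j'.
case: p p' ltp ltp' lr gr E => [[i a] b] [[i' a'] b'] /=.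
rewrite /row /= => lti _ lr gr E; have ei : i = i' by lia.
subst i'; clear lj gj lr gr ltj'.
(* The blocks agree, and the missing corner is the square of the block outside
   the footprint. *)
have ltr : i + a < 6 by case: a {E}; lia.
have ltx : j + b < n by case: b {E}; lia.
move/setP/(_ (Ordinal ltr, Ordinal ltx)): E.
rewrite !mem_footprint /covers /row /= leq_addr addKn !eqxx.
by case: a a' b b' {ltr ltx} => [] [] [] [] //=; lia.
Qed.

Lemma is_tromino_footprint n j p : row p < 5 -> j.+1 < n ->
  is_tromino (footprint n j p).
Proof.
case: p => [[i a] b]; rewrite /row /= => lti ltj.
have ltr : i + a < 6 by case: a; lia.
have ltx : j + b < n by case: b; lia.
have lti6 : i < 6 by lia.
have ltjn : j < n by lia.
apply/existsP; exists (Ordinal lti6); apply/existsP; exists (Ordinal ltjn).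
apply/and3P; split=> //=.
apply/existsP; exists (Ordinal ltr, Ordinal ltx); apply/andP; split.
  by rewrite inE /=; case: a b {ltr ltx} => [] []; lia.
apply/eqP/setP=> -[r x].
rewrite !inE xpair_eqE -!val_eqE /= /covers /row /=.
by case: a b {ltr ltx} => [] []; lia.
Qed.

Lemma count_le1_inj (T : eqType) (a : pred T) (s : seq T) x y :
  count a s <= 1 -> x \in s -> y \in s -> a x -> a y -> x = y.
Proof.
rewrite -size_filter => le1 xs ys ax ay.
have: x \in filter a s by rewrite mem_filter ax.
have: y \in filter a s by rewrite mem_filter ay.
by case: filter le1 => [|z [|? ?]] //= _; rewrite !inE => /eqP-> /eqP->.
Qed.

Lemma covers_free_row p d : covers p (row p + ~~ p.1.2) d = (d <= 1).
Proof. by case: p => [[i a] b]; rewrite /covers /row /=; case: a; lia. Qed.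

Lemma covers_free_col p r : covers p r (~~ p.2) = (row p <= r <= (row p).+1).
Proof. by case: p => [[i a] b]; rewrite /covers /row /=; case: b; lia. Qed.

Section WordTiling.

Context (n : nat) (w : seq move).
Hypothesis size_w : size w = n.
Hypothesis good_w : fault_avoiding flat w.

Let state := incoming flat w.

Lemma row_lt5 x p : p \in nth [::] w x -> row p < 5.
Proof.
have [ltx|lex] := ltnP x (size w); last by rewrite nth_default.
have [/(_ x ltx) + _ _] := fault_avoidingP good_w.
by case/and4P=> /allP rows _ _ _; apply: rows.
Qed.

Lemma fits_col x : x < n -> fits (state x) (nth [::] w x).
Proof.
by rewrite -size_w; have [fit_w _ _] := fault_avoidingP good_w; apply: fit_w.
Qed.

Lemma load_col x r : x < n -> r < 6 ->
  load (state x) (nth [::] w x) r 0 = 1 /\ load (state x) (nth [::] w x) r 1 <= 1.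
Proof.
move=> /fits_col /and4P[_ _ /allP ovl /allP full] ltr.
have r6 : r \in iota 0 6 by rewrite mem_iota.
by have /andP[_ ->] := ovl r r6; have /eqP-> := full r r6.
Qed.

Lemma nth_after m r : r < 6 ->
  nth false (after m) r = has (fun p => covers p r 1) m.
Proof. by move=> ltr; rewrite nth_mkseq. Qed.

(** The tromino would otherwise stick out of the rectangle, and then the profile
after the last column would not be empty. *)
Lemma col_lt x p : p \in nth [::] w x -> x.+1 < n.
Proof.
move=> px; have lt5 := row_lt5 px.
have [ltx|lex] := ltnP x (size w); last by rewrite nth_default in px.
rewrite -size_w ltn_neqAle ltx andbT; apply/eqP => ex.
have [_ _] := fault_avoidingP good_w; rewrite -ex /= => flat_x.
have ltr : row p + ~~ p.1.2 < 6 by case: (p.1.2); lia.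
have := nth_after (nth [::] w x) ltr; rewrite flat_x nth_nseq ltr.
by move/esym/hasP; apply; exists p; rewrite ?covers_free_row.
Qed.

(** The incoming profile tells which of the two columns, that of the square or
the one before, the tile through a square is attached to. *)
Lemma cover_exists (c : square 6 n) :
  exists2 T, T \in tiling_of_word n w & c \in T.
Proof.
case: c => r x; have [full _] := load_col (ltn_ord x) (ltn_ord r).
move: full; rewrite /load /=; case sx: (nth false _ _) => /= full.
  move: sx; rewrite /state /incoming; case ex: (nat_of_ord x) => [|y].
    by rewrite nth_nseq ltn_ord.
  rewrite nth_after // => /hasP[p pw cov].
  have lty : y < n by have := ltn_ord x; lia.
  exists (footprint n y p); last first.
    by rewrite mem_footprint ex leqnSn subSnn.
  by apply/tiling_of_wordP; exists (Ordinal lty), p.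
have /hasP[p pw cov] : has (fun p => covers p r 0) (nth [::] w x).
  by rewrite has_count; move: full; rewrite add0n => ->.
exists (footprint n x p); last by rewrite mem_footprint leqnn subnn.
by apply/tiling_of_wordP; exists x, p.
Qed.

(** Two tiles attached to the same column cannot meet because its move has load
at most one everywhere.  If they are attached to consecutive columns, a common
square would be counted both in the incoming profile and in the move, giving
load at least two. *)
Lemma cover_unique (c : square 6 n) j p j' p' :
  p \in nth [::] w j -> p' \in nth [::] w j' ->
  c \in footprint n j p -> c \in footprint n j' p' -> j = j' /\ p = p'.
Proof.
case: c => r x; rewrite !mem_footprint.
wlog lejj' : j p j' p' / j <= j'.
  move=> W pj pj' c1 c2; have [le|/ltnW le] := leqP j j'; first exact: W.
  by have [-> ->] := W _ _ _ _ le pj' pj c2 c1.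
move=> pj pj' /andP[lejx cov] /andP[lej'x cov'].
have lex : x <= j.+1 by move: cov; rewrite /covers; lia.
have [ex | ltxj] := eqVneq (nat_of_ord x) j.
  have ej : j' = j by lia.
  subst j'; split=> //; have [+ _] := load_col (ltn_ord x) (ltn_ord r).
  rewrite /load ex => full.
  have le1 : count (fun p => covers p r 0) (nth [::] w j) <= 1 by lia.
  move: cov cov'; rewrite ex subnn => c1 c2.
  exact: count_le1_inj le1 pj pj' c1 c2.
have ex : x = j.+1 :> nat by lia.
have [ej | nej] := eqVneq j' j.
  subst j'; split=> //.
  have [_ +] := load_col (ltnW (col_lt pj)) (ltn_ord r).
  rewrite /load /= => le1; move: cov cov'; rewrite ex subSnn => c1 c2.
  exact: count_le1_inj le1 pj pj' c1 c2.
have ej : j' = j.+1 by lia.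
subst j'; have [+ _] := load_col (ltn_ord x) (ltn_ord r).
rewrite /load ex /state /= nth_after //.
move: cov cov'; rewrite ex subSnn subnn => cov cov'.
have -> : has (fun p => covers p r 1) (nth [::] w j) by apply/hasP; exists p.
have : 0 < count (fun p => covers p r 0) (nth [::] w j.+1).
  by rewrite -has_count; apply/hasP; exists p'.
by case: count.
Qed.

Lemma tiling_of_word_tiling : tromino_tiling (tiling_of_word n w).
Proof.
have trom T : T \in tiling_of_word n w -> is_tromino T.
  case/tiling_of_wordP=> j [p [pw ->]].
  by apply: is_tromino_footprint (row_lt5 pw) (col_lt pw).
apply/andP; split; last by apply/forallP=> T; apply/implyP/trom.
apply/and3P; split.
- apply/eqP/setP=> c; rewrite in_setT; apply/bigcupP.
  by have [T TP cT] := cover_exists c; exists T.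
- apply/trivIsetP=> A B /tiling_of_wordP[j [p [pw ->]]].
  move=> /tiling_of_wordP[j' [p' [pw' ->]]]; apply: contraR.
  case/pred0Pn=> c /andP[/= c1 c2].
  by have [-> ->] := cover_unique pw pw' c1 c2.
- apply/negP=> /trom/existsP[i /existsP[j /and3P[lti ltj]]].
  case/existsP=> [[r x]] /andP[_ /eqP/setP T0].
  (* One of the two top squares of the block is not the missing corner. *)
  have [/= x1 | x1] := eqVneq (nat_of_ord x) j.
    move: (T0 (i, Ordinal ltj)); rewrite !inE xpair_eqE -!val_eqE /=; lia.
  move: (T0 (i, j)); rewrite !inE xpair_eqE -!val_eqE /=; lia.
Qed.

Lemma mem_tile x p :
  p \in nth [::] w x -> footprint n x p \in tiling_of_word n w.
Proof.
move=> px; apply/tiling_of_wordP.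
by exists (Ordinal (ltnW (col_lt px))), p.
Qed.

Lemma tiling_of_word_faultfree :
  (forall h, 0 < h < 6 -> exists x p, p \in nth [::] w x /\ (row p).+1 = h) ->
  faultfree (tiling_of_word n w).
Proof.
move=> crossed; apply/andP; split; apply/forallP => v; apply/negP.
  case/andP=> /crossed [x [p [px ev]]] /forallP fault.
  have [lt5 ltx] := (row_lt5 px, col_lt px).
  (* The column of the block without the missing corner lies in the tile, and it
     has a square on either side of the line. *)
  have ltx' : x + ~~ p.2 < n by case: (p.2); lia.
  have lt6 : row p < 6 by lia.
  have/implyP/(_ (mem_tile px)) := fault (footprint n x p).
  case/orP=> /forallP side.
    have /implyP := side (v, Ordinal ltx').
    by rewrite mem_footprint /= leq_addr addKn covers_free_col -ev; lia.
  have /implyP := side (Ordinal lt6, Ordinal ltx').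
  by rewrite mem_footprint /= leq_addr addKn covers_free_col -ev; lia.
case/andP=> /andP[v_gt0 _] /forallP fault.
have [_ flat_w _] := fault_avoidingP good_w.
have := flat_w v; rewrite v_gt0 size_w ltn_ord => /(_ isT).
case ev: (nat_of_ord v) v_gt0 => [//|x] _ /= not_flat.
(* A nonempty profile comes from a nonempty move; the row of the block without
   the missing corner has a square on either side of the line. *)
have [p px] : exists p, p \in nth [::] w x.
  case: (nth [::] w x) not_flat => [|p m] //.
  by exists p; rewrite mem_head.
have [lt5 ltx] := (row_lt5 px, col_lt px).
have lt6 : row p + ~~ p.1.2 < 6 by case: (p.1.2); lia.
have/implyP/(_ (mem_tile px)) := fault (footprint n x p).
case/orP=> /forallP side.
  have /implyP := side (Ordinal lt6, v).
  by rewrite mem_footprint /= ev subSnn covers_free_row; lia.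
have /implyP := side (Ordinal lt6, Ordinal (ltnW ltx)).
by rewrite mem_footprint /= subnn covers_free_row ev; lia.
Qed.

Lemma mem_tiling_of_word j p : row p < 5 -> j.+1 < n ->
  (footprint n j p \in tiling_of_word n w) = (p \in nth [::] w j).
Proof.
move=> ltp ltj; apply/tiling_of_wordP/idP => [[k [q [qw E]]]|pw].
  have [-> ->] // := footprint_inj ltp ltj (row_lt5 qw) (col_lt qw) E.
by exists (Ordinal (ltnW ltj)), p.
Qed.

End WordTiling.

Lemma tiling_of_word_inj n w w' : size w = n -> size w' = n ->
  fault_avoiding flat w -> fault_avoiding flat w' ->
  tiling_of_word n w = tiling_of_word n w' -> w = w'.
Proof.
move=> sw sw' gw gw' E; apply: (@eq_from_nth _ [::]); first by rewrite sw.
rewrite sw => x ltx.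
have /and4P[_ sorted1 _ _] := fits_col sw gw ltx.
have /and4P[_ sorted2 _ _] := fits_col sw' gw' ltx.
apply: irr_sorted_eq sorted1 sorted2 _.
- by move=> ? ? ?; apply: ltn_trans.
- by move=> ?; apply: ltnn.
move=> p; apply/idP/idP => pw.
  have [lt5 ltx1] := (row_lt5 gw pw, col_lt sw gw pw).
  by rewrite -(mem_tiling_of_word sw' gw') // -E (mem_tiling_of_word sw gw).
have [lt5 ltx1] := (row_lt5 gw' pw, col_lt sw' gw' pw).
by rewrite -(mem_tiling_of_word sw gw) // E (mem_tiling_of_word sw' gw').
Qed.

(** * Enumeration of the words *)

Definition profiles : seq profile :=
  iter 6 (fun ss => [seq b :: s | b <- [:: false; true], s <- ss]) [:: [::]].

Definition placements_at (i : nat) : seq placement :=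
  [seq (i, a, b) | a <- [:: false; true], b <- [:: false; true]].

(** Two trominoes in one block overlap, so a move takes at most one placement for
each of the five top rows.  Overlapping partial moves are dropped early only to
keep the search small; soundness rests on the last filter. *)
Definition moves (s : profile) : seq move :=
  let add ms i :=
    [seq m <- ms ++ [seq rcons m p | m <- ms, p <- placements_at i] |
     no_overlap s m] in
  [seq m <- foldl add [:: [::]] (iota 0 5) | fits s m].

Lemma movesP s : s \in profiles ->
  uniq (moves s) /\
  {in moves s, forall m, fits s m /\ after m \in profiles}.
Proof.
have /allP ok : all (fun s => uniq (moves s) &&
    all (fun m => after m \in profiles) (moves s)) profiles by vm_compute.
case/ok/andP=> uniq_s /allP ok_s; split=> // m ms; split; last exact: ok_s.
by move: ms; rewrite mem_filter => /andP[].
Qed.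

(** Since the empty profile has no completion of positive length, it cannot
occur strictly inside a word listed here. *)
Fixpoint completions (n : nat) (s : profile) : seq (seq move) :=
  if n is n'.+1 then
    if s == flat then [::]
    else [seq m :: w | m <- moves s, w <- completions n' (after m)]
  else if s == flat then [:: [::]] else [::].

Lemma completions0 s : completions 0 s = if s == flat then [:: [::]] else [::].
Proof. by []. Qed.

Lemma completionsS n s : completions n.+1 s =
  if s == flat then [::]
  else [seq m :: w | m <- moves s, w <- completions n (after m)].
Proof. by []. Qed.

Lemma completions_uniq n s : s \in profiles -> uniq (completions n s).
Proof.
elim: n s => [|n IHn] s sP; first by rewrite completions0; case: eqP.
rewrite completionsS; case: eqP => // _; have [uniq_s ok_s] := movesP sP.
apply: allpairs_uniq_dep => // [m /ok_s[_ /IHn] //|].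
by move=> [m w] [m' w'] _ _ [-> ->].
Qed.

Lemma completionsP n s w : s \in profiles -> w \in completions n s ->
  [/\ size w = n, fault_avoiding s w & (0 < n -> s != flat)].
Proof.
elim: n s w => [|n IHn] s w sP.
  by rewrite completions0; case: eqP => // ->; rewrite inE => /eqP->.
rewrite completionsS; case: eqP => // _; have [_ ok_s] := movesP sP.
case/allpairsPdep=> m [w' [ms w's ->]]; have [fit_m mP] := ok_s m ms.
have [sz good flat_m] := IHn _ _ mP w's.
split=> //; first by rewrite -sz.
rewrite /fault_avoiding -/fault_avoiding fit_m good andbT.
case: w' sz {w's good} => [|? ?] sz; first by rewrite orbT.
by rewrite flat_m // -sz.
Qed.

(** * Growth of the number of words *)

(** The transfer matrix, one row per profile, each row listing the indices of
its unit entries.  The row of the empty profile is zero, as is appropriate for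
words that avoid it. *)
Definition successors : seq (seq nat) :=
  [seq if s == flat then [::] else [seq index (after m) profiles | m <- moves s]
  | s <- profiles].

Definition transfer (A : seq (seq nat)) (v : seq nat) : seq nat :=
  [seq sumn [seq nth 0 v i | i <- r] | r <- A].

(** Evaluating this vector takes one pass over the matrix per column, whereas
the lists of completions have exponential length. *)
Definition counts (n : nat) : seq nat :=
  iter n (transfer successors) [seq nat_of_bool (s == flat) | s <- profiles].

Lemma size_completions n s : s \in profiles ->
  size (completions n s) = nth 0 (counts n) (index s profiles).
Proof.
elim: n s => [|n IHn] s sP.
  by rewrite completions0 (nth_map s) ?index_mem // nth_index //; case: eqP.
rewrite /counts iterS -/(counts n) completionsS.
rewrite (nth_map [::]) ?size_map ?index_mem //.
rewrite (nth_map s) ?index_mem // nth_index //.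
case: eqP => // _; rewrite size_allpairs_dep -map_comp; congr sumn.
apply/eq_in_map=> m ms; have [_ /(_ m ms)[_ mP]] := movesP sP.
exact: IHn.
Qed.

(** Four columns are the least for which the ratio over the next six columns
reaches 192 at all profiles that have completions. *)
Lemma counts_grow :
  let v := counts 4 in let v' := counts 10 in
  all (fun i => 192 * nth 0 v i <= nth 0 v' i) (iota 0 (size profiles)).
Proof. by vm_compute. Qed.

Lemma completions_grow n s : s \in profiles -> 4 <= n ->
  192 * size (completions n s) <= size (completions (n + 6) s).
Proof.
move=> sP; elim: n s sP => // n IHn s sP; rewrite leq_eqVlt => /predU1P[[<-]|].
  rewrite !(size_completions _ sP); apply: (allP counts_grow).
  by rewrite mem_iota index_mem.
rewrite ltnS addSn !completionsS => le4n; case: eqP => // _.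
rewrite !size_allpairs_dep !sumnE !big_map big_distrr.
rewrite big_seq [leqRHS]big_seq; apply: leq_sum => m ms.
have [_ /(_ m ms)[_ mP]] := movesP sP.
exact: IHn.
Qed.

(** * Faultfree tilings with a fixed left end *)

Definition lock : seq move :=
  [:: [:: (0, true, true); (2, false, true); (4, false, true)];
      [:: (1, false, true); (3, false, false)]].

Definition lock_profile : profile := [:: false; false; true; true; true; false].

Lemma lock_profile_in : lock_profile \in profiles.
Proof. by vm_compute. Qed.

Lemma counts_lock : 384 <= nth 0 (counts 10) (index lock_profile profiles).
Proof. by vm_compute. Qed.

Lemma completions_lock k :
  384 * 192 ^ k <= size (completions (10 + 6 * k) lock_profile).
Proof.
elim: k => [|k IHk].
  rewrite size_completions; [exact: counts_lock | exact: lock_profile_in].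
have -> : 10 + 6 * k.+1 = 10 + 6 * k + 6 by rewrite mulnS addnCA addnC.
have le4 : 4 <= 10 + 6 * k by apply: leq_trans (leq_addr _ _).
apply: leq_trans (completions_grow lock_profile_in le4).
by rewrite expnS mulnCA leq_mul2l IHk.
Qed.

Lemma lock_fault_avoiding n w : w \in completions n lock_profile ->
  size (lock ++ w) = n.+2 /\ fault_avoiding flat (lock ++ w).
Proof.
case/(completionsP lock_profile_in) => sz good _.
by rewrite size_cat sz /= good.
Qed.

Lemma lock_crosses w h : 0 < h < 6 ->
  exists x p, p \in nth [::] (lock ++ w) x /\ (row p).+1 = h.
Proof.
case: h => [|[|[|[|[|[|h]]]]]] // _.
- by exists 0, (0, true, true).
- by exists 1, (1, false, true).
- by exists 0, (2, false, true).
- by exists 1, (3, false, false).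
- by exists 0, (4, false, true).
Qed.

Lemma faultfree_ge_completions n :
  size (completions n lock_profile) <= #|faultfree_tilings 6 n.+2|.
Proof.
rewrite cardE.
pose f w := tiling_of_word n.+2 (lock ++ w).
rewrite -(size_map f); apply: uniq_leq_size.
  rewrite map_inj_in_uniq; first exact: (completions_uniq n lock_profile_in).
  move=> w w' /lock_fault_avoiding[sz good] /lock_fault_avoiding[sz' good'].
  by move/(tiling_of_word_inj sz sz' good good') => [].
move=> _ /mapP[w /lock_fault_avoiding[sz good] ->].
rewrite mem_enum inE tiling_of_word_tiling //.
by apply: tiling_of_word_faultfree => // h; apply: lock_crosses.
Qed.

(** Bernoulli's inequality (4 / 3) ^ k >= 1 + k / 3, multiplied by 3 * 144 ^ k. *)
Lemma linear_le_geometric k : (k + 3) * 144 ^ k <= 3 * 192 ^ k.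
Proof.
elim: k => // k IHk; rewrite !expnS mulnCA [leqRHS]mulnCA.
apply: leq_trans (leq_mul (leqnn 192) IHk).
by rewrite !mulnA leq_mul2r; apply/orP; right; lia.
Qed.

Theorem theorem6 (t : nat) (ht : 2 <= t) :
  128 * (t + 1) * 144 ^ (t - 2) <= #|faultfree_tilings 6 (6 * t)|.
Proof.
have -> : 6 * t = (10 + 6 * (t - 2)).+2 by lia.
apply: leq_trans (faultfree_ge_completions _).
apply: leq_trans (completions_lock _).
have := linear_le_geometric (t - 2).
have -> : t - 2 + 3 = t + 1 by lia.
lia.
Qed.
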